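(* The mapping $$s_{ij}(u)\mapsto \sum_{k\in \mathbb{Z}_N}\omega^{ik}y_{k,j-i}(u)\qquad(i,j\in\mathbb{Z}_N)$$ defines an isomorphism of the two presentations of $Y(\mathfrak{g}_N)$, i.e. from the algebra presented by the generators $s_{ij}^{(r)}$ to the algebra presented by the principal generators $y_{kl}^{(r)}$. The inverse mapping is given by $$y_{kl}(u)\mapsto \sum_{i\in \mathbb{Z}_N}\frac{\omega^{-ki}}{N}s_{i,i+l}(u)\qquad(k,l\in\mathbb{Z}_N).$$
   Context: Indices lie in $\mathbb{Z}_N=\{0,1,\dots,N-1\}$, with index arithmetic (also in the indices of $\theta$) modulo $N$; $\omega=e^{2\pi\sqrt{-1}/N}$. Two cases are treated: in the symmetric case ($\mathfrak{g}_N=\mathfrak{so}_N$), $\theta_i=1$ for all $i$; in the alternating case ($\mathfrak{g}_N=\mathfrak{sp}_N$), $N=2n$ is even and $\theta_i=-1$ for $0\le i\le n-1$, $\theta_i=1$ for $n\le i\le 2n-1$. In a double sign $\pm$ the upper sign is for $\mathfrak{so}_N$, the lower for $\mathfrak{sp}_N$. Maps are given on generating series and understood coefficientwise. First presentation: the twisted Yangian $Y(\mathfrak{g}_N)$ is the unital associative $\mathbb{C}$-algebra with generators $s_{ij}^{(r)}$ ($i,j\in\mathbb{Z}_N$, $r\ge 1$) and, with $s_{ij}(u)=\delta_{ij}+\sum_{r\ge 1}s_{ij}^{(r)}u^{-r}$ and $i'=N-1-i$, the defining relations $$\begin{aligned}(u^2-v^2)[s_{ij}(u),s_{kl}(v)]={}&(u+v)\bigl(s_{kj}(u)s_{il}(v)-s_{kj}(v)s_{il}(u)\bigr)\\&-(u-v)\bigl(\theta_k\theta_{j'}s_{ik'}(u)s_{j'l}(v)-\theta_i\theta_{l'}s_{ki'}(v)s_{l'j}(u)\bigr)\\&+\theta_i\theta_{j'}\bigl(s_{ki'}(u)s_{j'l}(v)-s_{ki'}(v)s_{j'l}(u)\bigr)\end{aligned}$$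 and $$\theta_i\theta_js_{j'i'}(-u)=s_{ij}(u)\pm\frac{s_{ij}(u)-s_{ij}(-u)}{2u}.$$ Second (principal) presentation: the unital associative $\mathbb{C}$-algebra with generators $y_{ij}^{(r)}$ ($i,j\in\mathbb{Z}_N$, $r\ge 1$) and, with $y_{ij}(u)=\sum_{r\ge 0}y_{ij}^{(r)}u^{-r}$, $y_{ij}^{(0)}=\delta_{i,0}\delta_{j,0}$, the relations (all sums over $\mathbb{Z}_N$; here $a',b'$ are independent summation indices) $$\begin{aligned} &(u^2-v^2)[y_{ij}(u),y_{kl}(v)]=\\ &\frac{u+v}{N}\sum_{a,b}\bigl(\omega^{b(i-k-a)}y_{i-a,j-b}(u)y_{k+a,l+b}(v)-\omega^{a(j-l-b)}y_{k+a,l+b}(v)y_{i-a,j-b}(u)\bigr)\\ &-\frac{u-v}{N^2}\sum_{a,b,a',b'}\theta_{a'}\theta_{a'+b}\,\omega^{-a-a'(a+b')+b'(j-b)-b(k+a)}\,y_{i-b',j-b}(u)y_{k+a,l+b}(v)\\ &+\frac{u-v}{N^2}\sum_{a,b,a',b'}\theta_{a'}\theta_{a'+b}\,\omega^{-a-a'(a+b')+b(i-b')-a(l+b)}\,y_{k+a,l+b}(v)y_{i-b',j-b}(u)\\ &+\frac{1}{N^3}\sum_{a,b,a',b',c,d}\theta_{a'}\theta_{a'+b}\,\omega^{-a-a'(a+b')+b'(j-b-d)-b(k+a+c)+d(i-k-c)}\,y_{i-c-b',j-d-b}(u)y_{k+a+c,l+b+d}(v)\\ &-\frac{1}{N^3}\sum_{a,b,a',b',c,d}\theta_{a'}\theta_{a'+b}\,\omega^{-a-a'(a+b')+b(i-c-b')-a(l+b+d)+c(j-l-d)}\,y_{k+a+c,l+b+d}(v)y_{i-c-b',j-d-b}(u)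 \end{aligned}$$ and $$\frac{1}{N}\sum_{k,l}\theta_{k}\theta_{k+j}\,\omega^{-l(1+j)-k(i+l)}y_{l,j}(-u)=y_{ij}(u)\pm\frac{y_{ij}(u)-y_{ij}(-u)}{2u}.$$ Writing $A_{kl}=\sum_{m}\omega^{mk}E_{m,m+l}$ with $E_{ij}$ the matrix units, the two sets of generators are related by $\sum_{i,j}s_{ij}(u)\otimes E_{ij}=\sum_{k,l}y_{kl}(u)\otimes A_{kl}$. *)

(* Defs.v *)
From HB Require Import structures.
From mathcomp Require Import all_boot all_order all_algebra.
From mathcomp Require Import boolp functions reals trigo.
From mathcomp Require Import complex.
From mathcomp Require Import finmap monalg.

Set Implicit Arguments.
Unset Strict Implicit.
Unset Printing Implicit Defensive.

Import Order.TTheory GRing.Theory Num.Theory.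

Local Open Scope ring_scope.

(** * Unital associative algebras given by generators and relations *)

(* {malg K[{fmonom I}]}, the monoid algebra of the free monoid on I, is the
   free unital associative K-algebra on I. *)
Notation free_alg K I := {malg K[{fmonom I}]}.

Section Presentation.
Variables (K : comNzRingType) (I : choiceType) (rel : free_alg K I -> Prop).

Definition free_gen (i : I) : free_alg K I := << fmu i >>.

Inductive rel_ideal : free_alg K I -> Prop :=
| rel_ideal0 : rel_ideal 0
| rel_idealD x y : rel_ideal x -> rel_ideal y -> rel_ideal (x + y)
| rel_idealM a x b : rel x -> rel_ideal (a * x * b).

Lemma rel_idealMlr a x b : rel_ideal x -> rel_ideal (a * x * b).
Proof.
elim=> [|y z _ Iy _ Iz|c y d ry].
- by rewrite mulr0 mul0r; exact: rel_ideal0.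
- by rewrite mulrDr mulrDl; exact: rel_idealD.
- have -> : a * (c * y * d) * b = a * c * y * (d * b) by rewrite !mulrA.
  exact: rel_idealM.
Qed.

Definition rel_idealb : {pred free_alg K I} := fun x => `[< rel_ideal x >].

Lemma rel_idealP x : reflect (rel_ideal x) (x \in rel_idealb).
Proof. exact: asboolP. Qed.

Lemma rel_ideal_zmod_closed : zmod_closed rel_idealb.
Proof.
split=> [|x y /rel_idealP Ix /rel_idealP Iy]; apply/rel_idealP.
  exact: rel_ideal0.
apply: rel_idealD => //.
by rewrite -mulN1r -[X in rel_ideal X]mulr1; exact: rel_idealMlr.
Qed.

HB.instance Definition _ :=
  GRing.isZmodClosed.Build (free_alg K I) rel_idealb rel_ideal_zmod_closed.

Definition presented := Quotient.quot rel_idealb.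

HB.instance Definition _ := GRing.Zmodule.on presented.

Definition pres_pi (x : free_alg K I) : presented :=
  \pi_(Quotient.quot rel_idealb)%qT x.

Definition pres_one : presented := pres_pi 1.
Definition pres_mul (x y : presented) : presented :=
  pres_pi (repr x * repr y).
Definition pres_scale (c : K) (x : presented) : presented :=
  pres_pi (c *: repr x).

Lemma pres_piP x y : pres_pi x = pres_pi y <-> rel_ideal (x - y).
Proof.
split=> [/eqP|h]; first by rewrite -Quotient.idealrBE => /rel_idealP.
by apply/eqP; rewrite -Quotient.idealrBE; apply/rel_idealP.
Qed.

Lemma pres_piK x : pres_pi (repr x) = x.
Proof. exact: reprK. Qed.

Lemma pres_piW (P : presented -> Prop) :
  (forall x, P (pres_pi x)) -> forall x, P x.
Proof. by move=> h x; rewrite -[x]pres_piK. Qed.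

Lemma pres_repr x : rel_ideal (repr (pres_pi x) - x).
Proof. by apply/pres_piP; rewrite pres_piK. Qed.

Lemma pres_piD : {morph pres_pi : x y / x + y}.
Proof. by move=> x y; rewrite /pres_pi piE. Qed.

Lemma pres_mulE x y : pres_mul (pres_pi x) (pres_pi y) = pres_pi (x * y).
Proof.
apply/pres_piP; set x' := repr _; set y' := repr _.
have -> : x' * y' - x * y = 1 * (x' - x) * y' + x * (y' - y) * 1.
  by rewrite mul1r mulr1 mulrBl mulrBr addrA subrK.
by apply: rel_idealD; apply: rel_idealMlr; exact: pres_repr.
Qed.

Lemma pres_scaleE c x : pres_scale c (pres_pi x) = pres_pi (c *: x).
Proof.
apply/pres_piP; rewrite -scalerBr -[X in rel_ideal X]mulr1.
by rewrite -mul_malgC; apply: rel_idealMlr; exact: pres_repr.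
Qed.

Lemma pres_mulA : associative pres_mul.
Proof.
by elim/pres_piW=> x; elim/pres_piW=> y; elim/pres_piW=> z;
  rewrite !pres_mulE mulrA.
Qed.

Lemma pres_mul1 : left_id pres_one pres_mul.
Proof. by elim/pres_piW=> x; rewrite pres_mulE mul1r. Qed.

Lemma pres_mulr1 : right_id pres_one pres_mul.
Proof. by elim/pres_piW=> x; rewrite pres_mulE mulr1. Qed.

Lemma pres_mulDl : left_distributive pres_mul +%R.
Proof.
by elim/pres_piW=> x; elim/pres_piW=> y; elim/pres_piW=> z;
  rewrite -pres_piD !pres_mulE mulrDl pres_piD.
Qed.

Lemma pres_mulDr : right_distributive pres_mul +%R.
Proof.
by elim/pres_piW=> x; elim/pres_piW=> y; elim/pres_piW=> z;
  rewrite -pres_piD !pres_mulE mulrDr pres_piD.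
Qed.

HB.instance Definition _ := GRing.Zmodule_isPzRing.Build presented
  pres_mulA pres_mul1 pres_mulr1 pres_mulDl pres_mulDr.

Lemma pres_scaleA a b x : pres_scale a (pres_scale b x) = pres_scale (a * b) x.
Proof. by elim/pres_piW: x => x; rewrite !pres_scaleE scalerA. Qed.

Lemma pres_scale1 : left_id 1 pres_scale.
Proof. by elim/pres_piW=> x; rewrite pres_scaleE scale1r. Qed.

Lemma pres_scaleDr : right_distributive pres_scale +%R.
Proof.
by move=> c; elim/pres_piW=> x; elim/pres_piW=> y;
  rewrite -pres_piD !pres_scaleE scalerDr pres_piD.
Qed.

Lemma pres_scaleDl x : {morph pres_scale^~ x : a b / a + b}.
Proof.
by elim/pres_piW: x => x a b; rewrite !pres_scaleE scalerDl pres_piD.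
Qed.

HB.instance Definition _ := GRing.Zmodule_isLmodule.Build K presented
  pres_scaleA pres_scale1 pres_scaleDr pres_scaleDl.

(* The library's lalgType and algType require 1 != 0, which fails for some
   presentations; presented is therefore a pzRingType with an lmodType
   structure satisfying the two algebra laws below. *)
Lemma pres_scaleAl (c : K) (x y : presented) : c *: (x * y) = (c *: x) * y.
Proof.
elim/pres_piW: x => x; elim/pres_piW: y => y.
change (pres_scale c (pres_mul (pres_pi x) (pres_pi y)) =
        pres_mul (pres_scale c (pres_pi x)) (pres_pi y)).
by rewrite pres_scaleE !pres_mulE pres_scaleE scalerAl.
Qed.

Lemma pres_scaleAr (c : K) (x y : presented) : c *: (x * y) = x * (c *: y).
Proof.
elim/pres_piW: x => x; elim/pres_piW: y => y.
change (pres_scale c (pres_mul (pres_pi x) (pres_pi y)) =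
        pres_mul (pres_pi x) (pres_scale c (pres_pi y))).
rewrite pres_scaleE !pres_mulE pres_scaleE; congr pres_pi.
apply/malgP=> m; rewrite mcoeffZ.
rewrite (mcoeffMlw m (fsubset_refl (msupp x)) (fsubset_refl (msupp y))).
rewrite (mcoeffMlw m (fsubset_refl (msupp x)) (msuppZ_le c y)).
rewrite mulr_sumr; apply: eq_bigr => k1 _.
rewrite mulr_sumr; apply: eq_bigr => k2 _.
by rewrite mcoeffZ mulrnAr mulrCA.
Qed.

End Presentation.

(** * Formal series in u^-1 and v^-1 *)

(* A series in u is the function int -> A sending p to its coefficient of u^p;
   an expression in u and v is the function int -> int -> A sending p and q to
   its coefficient of u^p v^q.  Sums and scalar multiples are pointwise. *)
Section Series.
Variables (K : fieldType) (A : lalgType K).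
Implicit Types (f g : int -> A) (F : int -> int -> A).

(* c + \sum_(r >= 1) x (r - 1) u^-r ; note that Negz r is - (r + 1) *)
Definition useries (c : A) (x : nat -> A) : int -> A :=
  fun p => match p with Posz 0 => c | Posz _.+1 => 0 | Negz r => x r end.

Definition neg_arg f : int -> A := fun p => ((-1) ^ p : K) *: f p.
Definition div_u f : int -> A := fun p => f (p + 1).

Definition mul_u F : int -> int -> A := fun p q => F (p - 1) q.
Definition mul_v F : int -> int -> A := fun p q => F p (q - 1).
Definition mul_uDv F : int -> int -> A := mul_u F + mul_v F.
Definition mul_uBv F : int -> int -> A := mul_u F - mul_v F.
Definition mul_u2Bv2 F : int -> int -> A := mul_u (mul_u F) - mul_v (mul_v F).

Definition prod_uv f g : int -> int -> A := fun p q => f p * g q.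
Definition prod_vu f g : int -> int -> A := fun p q => f q * g p.

End Series.

(* f(u) g(v) and f(v) g(u) *)
Notation "f *uv g" := (prod_uv f g) (at level 40, g at next level) : ring_scope.
Notation "f *vu g" := (prod_vu f g) (at level 40, g at next level) : ring_scope.

(** * The twisted Yangian *)

Variant gtype := orthogonal | symplectic.

Section TwistedYangian.
Variables (R : realType) (m : nat) (g : gtype).

Let N := m.+1.
Local Notation C := R[i].

(* 'I_N is a zmodType for the addition modulo N. *)
Implicit Types (i j k l a b c d : 'I_N) (e : int).

Definition omega : C :=
  (cos (2 * pi / N%:R) +i* sin (2 * pi / N%:R))%C.

Definition theta i : C :=
  if g is symplectic then if (i < N./2)%N then -1 else 1 else 1.

Definition pm : C := if g is symplectic then -1 else 1.

(* Generators of both presentations: (i, j, r) stands for the generator with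
   indices i, j and superscript r + 1. *)
Definition yangian_index := ('I_N * 'I_N * nat)%type.
Local Notation A := (free_alg C yangian_index).

Definition s_series i j : int -> A :=
  useries (i == j)%:R (fun r => free_gen C (i, j, r)).
Local Notation s := s_series.

(* rev_ord i is N - 1 - i. *)
Definition quaternary_lhs i j k l : int -> int -> A :=
  mul_u2Bv2 (s i j *uv s k l - s k l *vu s i j).

Definition quaternary_rhs i j k l : int -> int -> A :=
  mul_uDv (s k j *uv s i l - s k j *vu s i l)
  - mul_uBv
      ((theta k * theta (rev_ord j)) *: (s i (rev_ord k) *uv s (rev_ord j) l)
       - (theta i * theta (rev_ord l))
           *: (s k (rev_ord i) *vu s (rev_ord l) j))
  + (theta i * theta (rev_ord j))
      *: (s k (rev_ord i) *uv s (rev_ord j) l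
          - s k (rev_ord i) *vu s (rev_ord j) l).

Definition symmetry_lhs i j : int -> A :=
  (theta i * theta j) *: neg_arg (s (rev_ord j) (rev_ord i)).

Definition symmetry_rhs i j : int -> A :=
  s i j + pm *: (2^-1 *: div_u (s i j - neg_arg (s i j))).

Inductive yangian_rel : A -> Prop :=
| quaternary_rel i j k l p q :
    yangian_rel (quaternary_lhs i j k l p q - quaternary_rhs i j k l p q)
| symmetry_rel i j p :
    yangian_rel (symmetry_lhs i j p - symmetry_rhs i j p).

Definition yangian := presented yangian_rel.

Definition s_gen i j : int -> yangian := fun p => pres_pi yangian_rel (s i j p).

(** ** The principal presentation *)

Definition y_series i j : int -> A :=
  useries ((i == 0) && (j == 0))%:R (fun r => free_gen C (i, j, r)).
Local Notation y := y_series.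

(* Exponents of the root of unity are computed in int, on the representatives
   0, ..., N - 1 of the indices; the indices of y and theta are computed in
   'I_N, modulo N. *)
Local Notation z i := (Posz (nat_of_ord (i : 'I_N))).

Definition pquaternary_lhs i j k l : int -> int -> A :=
  mul_u2Bv2 (y i j *uv y k l - y k l *vu y i j).

Definition pquaternary_rhs i j k l : int -> int -> A :=
  N%:R^-1 *: mul_uDv (\sum_a \sum_b
    (omega ^ (z b * (z i - z k - z a))
       *: (y (i - a) (j - b) *uv y (k + a) (l + b))
     - omega ^ (z a * (z j - z l - z b))
       *: (y (k + a) (l + b) *vu y (i - a) (j - b))))
  - (N%:R ^+ 2)^-1 *: mul_uBv (\sum_a \sum_b \sum_a' \sum_b'
      (theta a' * theta (a' + b)
       * omega ^ (- z a - z a' * (z a + z b') + z b' * (z j - z b)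
                          - z b * (z k + z a)))
        *: (y (i - b') (j - b) *uv y (k + a) (l + b)))
  + (N%:R ^+ 2)^-1 *: mul_uBv (\sum_a \sum_b \sum_a' \sum_b'
      (theta a' * theta (a' + b)
       * omega ^ (- z a - z a' * (z a + z b') + z b * (z i - z b')
                          - z a * (z l + z b)))
        *: (y (k + a) (l + b) *vu y (i - b') (j - b)))
  + (N%:R ^+ 3)^-1 *:
    (\sum_a \sum_b \sum_a' \sum_b' \sum_c \sum_d
      (theta a' * theta (a' + b)
       * omega ^ (- z a - z a' * (z a + z b')
                          + z b' * (z j - z b - z d)
                          - z b * (z k + z a + z c) + z d * (z i - z k - z c)))
        *: (y (i - c - b') (j - d - b) *uv y (k + a + c) (l + b + d)))
  - (N%:R ^+ 3)^-1 *:
    (\sum_a \sum_b \sum_a' \sum_b' \sum_c \sum_d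
      (theta a' * theta (a' + b)
       * omega ^ (- z a - z a' * (z a + z b')
                          + z b * (z i - z c - z b')
                          - z a * (z l + z b + z d) + z c * (z j - z l - z d)))
        *: (y (k + a + c) (l + b + d) *vu y (i - c - b') (j - d - b))).

Definition psymmetry_lhs i j : int -> A :=
  N%:R^-1 *: (\sum_k \sum_l
    (theta k * theta (k + j)
     * omega ^ (- z l * (1 + z j) - z k * (z i + z l)))
      *: neg_arg (y l j)).

Definition psymmetry_rhs i j : int -> A :=
  y i j + pm *: (2^-1 *: div_u (y i j - neg_arg (y i j))).

Inductive pyangian_rel : A -> Prop :=
| pquaternary_rel i j k l p q :
    pyangian_rel (pquaternary_lhs i j k l p q - pquaternary_rhs i j k l p q)
| psymmetry_rel i j p :
    pyangian_rel (psymmetry_lhs i j p - psymmetry_rhs i j p).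

Definition principal_yangian := presented pyangian_rel.

Definition y_gen i j : int -> principal_yangian :=
  fun p => pres_pi pyangian_rel (y i j p).

End TwistedYangian.

Arguments s_gen {R m} g i j p.
Arguments y_gen {R m} g i j p.

(* Main.v *)
Require Import Defs.
From HB Require Import structures.
From mathcomp Require Import all_boot all_order all_algebra.
From mathcomp Require Import boolp functions reals trigo.
From mathcomp Require Import complex.
From mathcomp Require Import finmap monalg.
From mathcomp Require Import ring zify.

Import Order.TTheory GRing.Theory Num.Theory.

Set Implicit Arguments.
Unset Strict Implicit.
Unset Printing Implicit Defensive.

Local Open Scope ring_scope.

(** The substitution s_ij = sum_k w^(ik) y_(k,j-i) is a discrete Fourier transform
    in the row index along each diagonal j - i = l of the matrix of generators.
    It is an invertible linear change of generators, so it induces mutually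
    inverse automorphisms s_to_y and y_to_s of the free algebra (s_to_yK,
    y_to_sK), and everything reduces to showing that these exchange the two
    ideals of relations.

    Applied to both tensor factors, the same transform (fourier2) acts on arrays
    G i j k l, which stand for the coefficients of a product such as
    y_ij(u) y_kl(v).  In matrix form the quaternary relation of the first
    presentation reads R(u - v) S_1(u) R'(-u - v) S_2(v) = (its mirror image),
    where R involves the permutation operator of C^N (x) C^N and R' its partial
    transpose.  Entrywise these two operators are the index substitutions
    (i,j,k,l) -> (k,j,i,l) and (i,j,k,l) -> (i,k',j',l), the second with a
    theta sign.  Conjugating them with fourier2 produces character sums over
    Z_N that collapse to the double sum pswap and the fourfold sum pcontract
    (fourier2_pswap, fourier2_pcontract), and these are exactly the sums of the
    second presentation; its sixfold sums are the composite of pswap and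
    pcontract (pswap_pcontract).  The transposition in the symmetry relation is
    treated in the same way (fourier_ptranspose).

    Hence s_to_y sends each quaternary relation to the fourier2-transform of the
    family of principal quaternary relations, and each symmetry relation to the
    fourier-transform of the principal ones (s_to_y_quaternary,
    s_to_y_symmetry): the images lie in the principal ideal.  Inverting these
    finite transforms expresses every principal relation through images of
    original ones, which gives the converse inclusion (y_to_s_rel). *)

(** * Free algebras and presented algebras *)

Section FreeAlgebra.
Variables (K : comNzRingType) (I : choiceType).
Local Notation A := (free_alg K I).
Implicit Types (c : K) (x y : A).

Lemma free_scaleU c a (w : {fmonom I}) : c *: << a *g w >> = << c * a *g w >>.
Proof. by rewrite -mul_malgC malgM_def fgmulUU mul1m. Qed.

(** The monoid algebra of a noncommutative monoid carries only a left algebra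
    structure; with commutative scalars the right law holds as well. *)
Lemma free_scalerAr c x y : c *: (x * y) = x * (c *: y).
Proof.
rewrite (malgMEw (fsubset_refl (msupp x)) (msuppZ_le c y)) malgME scaler_sumr.
apply: eq_bigr => k _; rewrite scaler_sumr; apply: eq_bigr => l _.
by rewrite free_scaleU mcoeffZ mulrCA.
Qed.

Lemma free_algC_comm c x : GRing.comm (malgC c) x.
Proof.
have mulCE y : malgC c * y = c *: y by exact: mul_malgC.
by rewrite /GRing.comm mulCE -[malgC c]mulr1 mulCE -free_scalerAr mulr1.
Qed.

(** Words are built letter by letter and the free algebra is spanned by words. *)
Lemma free_alg_ind (P : A -> Prop) :
  P 1 -> (forall i x, P x -> P (free_gen K i * x)) ->
  (forall c x y, P x -> P y -> P (c *: x + y)) -> forall x, P x.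
Proof.
move=> P1 PM Plin.
have P0 : P 0 by rewrite -(addNr 1) -scaleN1r; exact: Plin.
have Pmon (w : seq I) : P << FMonom w >>.
  elim: w => [|i w Pw]; first by rewrite -fmoneE.
  suff -> : << FMonom (i :: w) >> = free_gen K i * << FMonom w >> by exact: PM.
  by rewrite /free_gen malgM_def fgmulUU mulr1 /mmul /= fmmulE fmuE.
move=> x; rewrite (monalgE x).
elim/big_ind: _ => // [y z Py Pz|[w] _]; first by rewrite -[y]scale1r; exact: Plin.
suff -> : << x@_(FMonom w) *g FMonom w >> = x@_(FMonom w) *: << FMonom w >>.
  by rewrite -[_ *: _]addr0; exact: Plin.
by rewrite free_scaleU mulr1.
Qed.

End FreeAlgebra.

Section Substitution.
Variables (K : comNzRingType) (I B : choiceType) (F : I -> free_alg K B).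
Local Notation A := (free_alg K I).

Definition fmonom_eval (w : {fmonom I}) : free_alg K B := \prod_(i <- w) F i.

Lemma fmonom_eval_mmorphism : mmorphism fmonom_eval.
Proof.
split=> [v w|]; rewrite /fmonom_eval; first by rewrite fmM big_cat.
by rewrite fm1 big_nil.
Qed.

HB.instance Definition _ := isMultiplicative.Build {fmonom I} (free_alg K B)
  fmonom_eval fmonom_eval_mmorphism.

(** The universal property of the free algebra; centrality of the scalars is
    what makes it multiplicative. *)
Definition free_subst : A -> free_alg K B := mmap (@malgC {fmonom B} K) fmonom_eval.

HB.instance Definition _ := GRing.Additive.on free_subst.

Lemma free_subst_multiplicative : multiplicative free_subst.
Proof. by apply: commr_mmap_is_multiplicative => x v w; exact: free_algC_comm. Qed.

HB.instance Definition _ := GRing.isMultiplicative.Build A (free_alg K B)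
  free_subst free_subst_multiplicative.

Lemma free_subst_scalable : scalable free_subst.
Proof. by move=> c x; rewrite /free_subst mmapZ mul_malgC. Qed.

HB.instance Definition _ := GRing.isScalable.Build K A (free_alg K B) *:%R
  free_subst free_subst_scalable.

Lemma free_subst_gen i : free_subst (free_gen K i) = F i.
Proof.
by rewrite /free_subst mmapU mul_malgC scale1r /= /fmonom_eval fmU big_seq1.
Qed.

End Substitution.

Lemma pres_pi_sum (K : comNzRingType) (I : choiceType)
    (rel : free_alg K I -> Prop) (T : finType) (F : T -> free_alg K I) :
  pres_pi rel (\sum_t F t) = \sum_t pres_pi rel (F t).
Proof.
apply: (big_morph _ (@pres_piD _ _ rel)); apply: (addrI (pres_pi rel 0)).
by rewrite -pres_piD !addr0.
Qed.

Lemma pres_piB (K : comNzRingType) (I : choiceType) (rel : free_alg K I -> Prop) :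
  {morph pres_pi rel : x y / x - y}.
Proof.
by move=> x y; apply: (addIr (pres_pi rel y)); rewrite subrK -pres_piD subrK.
Qed.

Section PresentedMap.
Variables (K : comNzRingType) (I J : choiceType).
Variables (rel : free_alg K I -> Prop) (rel' : free_alg K J -> Prop).
Variable f : {lrmorphism free_alg K I -> free_alg K J}.

(** The proof that relations go into the ideal is an argument of the map, so that
    the morphism structures declared below can depend on it. *)
Definition pres_map of (forall x, rel x -> rel_ideal rel' (f x)) :=
  fun x : presented rel => pres_pi rel' (f (repr x)).

Hypothesis f_rel : forall x, rel x -> rel_ideal rel' (f x).
Local Notation fbar := (pres_map f_rel).

Lemma pres_mapE x : fbar (pres_pi rel x) = pres_pi rel' (f x).
Proof.
apply/pres_piP; rewrite -rmorphB.
elim: (pres_repr rel x) => [|y z _ Iy _ Iz|a y b /f_rel Iy].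
- by rewrite rmorph0; exact: rel_ideal0.
- by rewrite rmorphD; exact: rel_idealD.
- by rewrite !rmorphM; exact: rel_idealMlr.
Qed.

Lemma pres_map_additive : additive fbar.
Proof.
by elim/pres_piW=> x; elim/pres_piW=> y; rewrite -pres_piB !pres_mapE rmorphB pres_piB.
Qed.

HB.instance Definition _ :=
  GRing.isAdditive.Build (presented rel) (presented rel') fbar pres_map_additive.

Lemma pres_map_multiplicative : multiplicative fbar.
Proof.
split; last by rewrite -[1]/(pres_pi rel 1) pres_mapE rmorph1.
elim/pres_piW=> x; elim/pres_piW=> y.
rewrite -[_ * _]/(pres_mul _ _) pres_mulE !pres_mapE.
by rewrite rmorphM -pres_mulE.
Qed.

HB.instance Definition _ :=
  GRing.isMultiplicative.Build (presented rel) (presented rel') fbar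
    pres_map_multiplicative.

Lemma pres_map_scalable : scalable fbar.
Proof.
move=> c; elim/pres_piW=> x.
rewrite -[_ *: _]/(pres_scale c _) pres_scaleE !pres_mapE.
by rewrite linearZ -pres_scaleE.
Qed.

End PresentedMap.

Lemma pres_map_cancel (K : comNzRingType) (I J : choiceType)
    (rel : free_alg K I -> Prop) (rel' : free_alg K J -> Prop)
    (f : {lrmorphism free_alg K I -> free_alg K J})
    (h : {lrmorphism free_alg K J -> free_alg K I})
    (f_rel : forall x, rel x -> rel_ideal rel' (f x))
    (h_rel : forall x, rel' x -> rel_ideal rel (h x)) :
  cancel f h -> cancel (pres_map f_rel) (pres_map h_rel).
Proof. by move=> fK; elim/pres_piW=> x; rewrite !pres_mapE fK. Qed.

Section IdealClosure.
Variables (K : comNzRingType) (I : choiceType) (rel : free_alg K I -> Prop).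

Lemma rel_ideal_gen x : rel x -> rel_ideal rel x.
Proof. by move=> rx; rewrite -[x]mulr1 -[x]mul1r; exact: rel_idealM. Qed.

Lemma rel_idealZ c x : rel_ideal rel x -> rel_ideal rel (c *: x).
Proof. by move=> Ix; rewrite -mul_malgC -[_ * x]mulr1; exact: rel_idealMlr. Qed.

Lemma rel_ideal_sum (T : finType) (F : T -> free_alg K I) :
  (forall t, rel_ideal rel (F t)) -> rel_ideal rel (\sum_t F t).
Proof.
by move=> IF; elim/big_ind: _ => // [|x y]; [exact: rel_ideal0 | exact: rel_idealD].
Qed.

End IdealClosure.

(** * The root of unity *)

Section RootOfUnity.
Variables (R : realType) (m : nat).
Local Notation N := m.+1.
Local Notation w := (omega R m).
Local Notation z i := (Posz (nat_of_ord (i : 'I_N))).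

Lemma omegaX n :
  w ^+ n = (cos (2 * pi / N%:R * n%:R) +i* sin (2 * pi / N%:R * n%:R))%C.
Proof.
rewrite /omega; move: (2 * pi / _) => t.
elim: n => [|n IHn]; first by rewrite mulr0 cos0 sin0 expr0.
rewrite exprS IHn -[n.+1%:R]natr1 mulrDr mulr1 [_ + t]addrC cosD sinD.
by apply/eqP; rewrite eq_complex /= eqxx /= [sin _ * cos _ + _]addrC.
Qed.

(** If w^n = 1 with 0 < n < N then cos (2t) = 1 for t = n pi / N, that is
    sin t = 0, which is impossible for 0 < t < pi. *)
Lemma omega_prim : N.-primitive_root w.
Proof.
apply/andP; split=> //; apply/forallP=> -[n n_lt_N] /=; apply/eqP.
have N0 : N%:R != 0 :> R by rewrite pnatr_eq0.
rewrite unity_rootE omegaX; case: (eqVneq n.+1 N) => [->|nN].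
  by rewrite divfK // mulr_natl cos2pi sin2pi !eqxx.
apply/negbTE; rewrite eq_complex /= negb_and; apply/orP; left.
pose t : R := pi / N%:R * n.+1%:R.
have -> : 2 * pi / N%:R * n.+1%:R = t *+ 2.
  by rewrite /t; ring.
rewrite cos_mulr2n cos2sin2 -subr_eq0.
have -> : (1 - sin t ^+ 2) *+ 2 - 1 - 1 = - (sin t ^+ 2 *+ 2) by ring.
rewrite oppr_eq0 mulrn_eq0 /= expf_eq0 /=; apply/lt0r_neq0/sin_gt0_pi.
rewrite mulr_gt0 ?ltr0n ?divr_gt0 ?pi_gt0 ?ltr0n //=.
rewrite /t mulrAC ltr_pdivrMr ?ltr0n // ltr_pM2l ?pi_gt0 // ltr_nat.
by rewrite ltn_neqAle nN.
Qed.

Lemma omega_neq0 : w != 0.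
Proof.
apply/eqP=> w0; have := prim_expr_order omega_prim.
by rewrite w0 expr0n /= => /eqP; rewrite eq_sym oner_eq0.
Qed.

Lemma omegaD (e f : int) : w ^ (e + f) = w ^ e * w ^ f.
Proof. by rewrite expfzDr ?omega_neq0. Qed.

(** Exponents of w matter modulo N only.  Quantifying over all rings of
    characteristic dividing N turns congruences between polynomial expressions
    in residues into identities that the ring tactic settles. *)
Lemma omega_eq (e f : int) :
  (forall S : comNzRingType, N%:R = 0 :> S -> e%:~R = f%:~R :> S) -> w ^ e = w ^ f.
Proof.
move=> ef; suff w1 : w ^ (e - f) = 1 by rewrite -(subrK f e) omegaD w1 mul1r.
have {ef} : (N %| `|e - f|)%N.
  (* No nontrivial ring has N = 0 when N = 1, but then divisibility is trivial;
     otherwise Z/N itself is the test ring. *)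
  case: {2}m (erefl m) => [|n] mn; first by rewrite mn dvd1n.
  have : (e - f)%:~R = 0 :> 'Z_n.+2.
    by rewrite intrB ef ?subrr // mn pchar_Zp.
  have dvd0 k : k%:R = 0 :> 'Z_n.+2 -> (n.+2 %| k)%N.
    by move/(congr1 val); rewrite /= val_Zp_nat // => /eqP.
  case: (e - f) => k; rewrite ?NegzE ?mulrNz -pmulrn ?abszN mn.
    exact: dvd0.
  by move/eqP; rewrite oppr_eq0 => /eqP /dvd0.
have wN : w ^+ N = 1 by exact: prim_expr_order omega_prim.
case: (e - f) => k /dvdnP[q]; rewrite ?NegzE ?absz_nat ?abszN /= ?absz_nat => ->.
  by rewrite -exprnP mulnC exprM wN expr1n.
by rewrite -invr_expz -exprnP mulnC exprM wN expr1n invr1.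
Qed.

Section Residues.
Variable S : comNzRingType.
Hypothesis N0 : N%:R = 0 :> S.
Implicit Types i j : 'I_N.

Lemma natr_mod n : (n %% N)%:R = n%:R :> S.
Proof. by rewrite [in RHS](divn_eq n N) natrD natrM N0 mulr0 add0r. Qed.

Lemma intr_ordD i j : (z (i + j))%:~R = (z i)%:~R + (z j)%:~R :> S.
Proof. by rewrite -!pmulrn natr_mod natrD. Qed.

Lemma intr_ordN i : (z (- i))%:~R = - (z i)%:~R :> S.
Proof.
by rewrite -!pmulrn natr_mod natrB ?N0 ?sub0r // ltnW.
Qed.

Lemma intr_rev i : (z (rev_ord i))%:~R = - 1 - (z i)%:~R :> S.
Proof. by rewrite -!pmulrn natrB // N0 -natr1 sub0r opprD addrC. Qed.

End Residues.

End RootOfUnity.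

(** Proves equality of two powers of w whose exponents agree modulo N, where the
    exponents are polynomials in representatives of sums, opposites and reversals
    of residues. *)
Ltac omega_congr :=
  apply: omega_eq; let S := fresh "S" in let N0 := fresh "N0" in move=> S N0;
  rewrite ?(intrD, intrM, mulrNz) ?(intr_rev N0, intr_ordD N0, intr_ordN N0); ring.

(** * The Fourier transform of arrays indexed by residues *)

Lemma rev_ordB m (i j : 'I_m.+1) : rev_ord i - rev_ord j = j - i.
Proof.
suff revE (a : 'I_m.+1) : rev_ord a = rev_ord 0 - a.
  by rewrite (revE i) (revE j) opprB addrC addrA subrK.
apply: (addIr a); rewrite subrK; apply: val_inj => /=.
by have aN := ltn_ord a; rewrite modn_small; lia.
Qed.

Section Fourier.
Variables (R : realType) (m : nat) (V : lmodType R[i]).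
Local Notation N := m.+1.
Local Notation w := (omega R m).
Local Notation z i := (Posz (nat_of_ord (i : 'I_N))).
Implicit Types (i j k l a b c d : 'I_N).

Lemma N_neq0 : N%:R != 0 :> R[i].
Proof. by rewrite pnatr_eq0. Qed.

(** Orthogonality of the characters of Z_N: a geometric sum of ratio u <> 1 with
    u^N = 1 vanishes. *)
Lemma sum_omega i j : \sum_a w ^ (z a * (z i - z j)) = (N * (i == j))%:R.
Proof.
case: eqVneq => [->|ij]; rewrite ?muln1 ?muln0.
  under eq_bigr do rewrite subrr mulr0 expr0z.
  by rewrite sumr_const card_ord.
set u := w ^ (z i - z j).
have -> : \sum_a w ^ (z a * (z i - z j)) = \sum_(a < N) u ^+ a.
  by apply: eq_bigr => a _; rewrite /u exprnP exprz_exp mulrC.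
have u1 : u != 1.
  apply: contraNneq ij => u1; apply/eqP/val_inj/eqP => /=.
  have : w ^+ i == w ^+ j.
    by rewrite -[w ^+ i]/(w ^ (z i)) -(subrK (z j) (z i)) omegaD -/u u1 mul1r.
  by rewrite (eq_prim_root_expr (omega_prim R m)) !modn_small.
have wN : w ^+ N = 1 by exact: prim_expr_order (omega_prim R m).
have u1' : u - 1 != 0 by rewrite subr_eq0.
apply: (mulfI u1'); rewrite mulr0 -subrX1 /u exprnP exprz_exp mulrC -exprz_exp.
by rewrite -exprnP wN exp1rz subrr.
Qed.

(** The two collapse lemmas are how orthogonality is used throughout: a free
    summation index a paired with t - t0 forces t = t0. *)
Lemma fourier_collapse (F : 'I_N -> V) t0 :
  \sum_a \sum_t w ^ (z a * (z t - z t0)) *: F t = N%:R *: F t0.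
Proof.
rewrite exchange_big /=; under eq_bigr do rewrite -scaler_suml sum_omega.
rewrite (bigD1 t0) //= eqxx muln1 big1 ?addr0 // => t /negbTE->.
by rewrite muln0 scale0r.
Qed.

Lemma fourier_collapseN (F : 'I_N -> V) t0 :
  \sum_a \sum_t w ^ (z a * (z t0 - z t)) *: F t = N%:R *: F t0.
Proof.
rewrite exchange_big /=; under eq_bigr do rewrite -scaler_suml sum_omega.
rewrite (bigD1 t0) //= eqxx muln1 big1 ?addr0 // => t.
by rewrite eq_sym => /negbTE->; rewrite muln0 scale0r.
Qed.

(** If f k l is the coefficient of A_kl = sum_m w^(mk) E_(m,m+l), then fourier f i j
    is the coefficient of the matrix unit E_ij of the same matrix. *)
Definition fourier (f : 'I_N -> 'I_N -> V) i j : V :=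
  \sum_k w ^ (z i * z k) *: f k (j - i).

Definition ifourier (f : 'I_N -> 'I_N -> V) k l : V :=
  \sum_i (w ^ (- (z k * z i)) / N%:R) *: f i (i + l).

Lemma ifourierK f i j : fourier (ifourier f) i j = f i j.
Proof.
apply: (scalerI N_neq0); rewrite -[f i j](congr1 (f i) (subrK i j)) addrC.
rewrite -(fourier_collapseN (fun a => f a (a + (j - i)))) scaler_sumr.
apply: eq_bigr => x _; rewrite !scaler_sumr; apply: eq_bigr => a _.
rewrite !scalerA [_ * (_ / _)]mulrA mulrC divfK ?N_neq0 //.
by congr (_ *: _); rewrite -omegaD; omega_congr.
Qed.

Lemma fourierK f i j : ifourier (fourier f) i j = f i j.
Proof.
apply: (scalerI N_neq0).
rewrite -(fourier_collapse (fun x => f x j)) scaler_sumr.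
apply: eq_bigr => a _; rewrite !scaler_sumr; apply: eq_bigr => x _.
rewrite addrC addKr !scalerA mulrA [N%:R * _]mulrC divfK ?N_neq0 //.
by congr (_ *: _); rewrite -omegaD; omega_congr.
Qed.

(** The change of basis from A_ij (x) A_kl to E_ij (x) E_kl. *)
Definition fourier2 (G : 'I_N -> 'I_N -> 'I_N -> 'I_N -> V) i j k l : V :=
  \sum_a \sum_c w ^ (z i * z a + z k * z c) *: G a (j - i) c (l - k).

Definition ifourier2 (G : 'I_N -> 'I_N -> 'I_N -> 'I_N -> V) i j k l : V :=
  (N%:R ^+ 2)^-1 *:
    \sum_a \sum_c w ^ (- (z i * z a) - z k * z c) *: G a (a + j) c (c + l).

Lemma scale_exchange_big2 (e : 'I_N -> 'I_N -> R[i])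
    (F : 'I_N -> 'I_N -> 'I_N -> 'I_N -> V) :
  \sum_x \sum_y e x y *: \sum_a \sum_b F x y a b
    = \sum_a \sum_b \sum_x \sum_y e x y *: F x y a b.
Proof.
under eq_bigr do under eq_bigr do rewrite pair_bigA scaler_sumr.
rewrite pair_bigA exchange_big /=.
rewrite -(pair_bigA _ (fun a b => \sum_p e p.1 p.2 *: F p.1 p.2 a b)) /=.
by apply: eq_bigr => a _; apply: eq_bigr => b _; rewrite pair_bigA.
Qed.

Lemma fourier2K G i j k l : ifourier2 (fourier2 G) i j k l = G i j k l.
Proof.
have N2 : N%:R ^+ 2 != 0 :> R[i] by rewrite expf_neq0 ?N_neq0.
apply: (scalerI N2); rewrite scalerA mulfV // scale1r exprS -scalerA.
rewrite -(fourier_collapse (fun x => N%:R *: G x j k l)); apply: eq_bigr => a _.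
transitivity (\sum_x w ^ (z a * (z x - z i)) *:
   \sum_c \sum_y w ^ (z c * (z y - z k)) *: G x j y l); last first.
  by apply: eq_bigr => x _; rewrite fourier_collapse.
rewrite /fourier2; under eq_bigr do rewrite scaler_sumr.
rewrite exchange_big; apply: eq_bigr => x _.
rewrite scaler_sumr; apply: eq_bigr => c _.
rewrite !scaler_sumr; apply: eq_bigr => y _.
rewrite [a + j]addrC addrK [c + l]addrC addrK !scalerA -!omegaD.
by congr (_ *: _); omega_congr.
Qed.

Lemma fourier2Z (c : R[i]) G i j k l :
  fourier2 (fun i j k l => c *: G i j k l) i j k l = c *: fourier2 G i j k l.
Proof.
rewrite scaler_sumr; apply: eq_bigr => x _.
rewrite scaler_sumr; apply: eq_bigr => y _.
by rewrite !scalerA mulrC.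
Qed.

(** The permutation operator in the basis of the A_kl: pswap is fourier2-conjugate
    to the exchange of the two row indices. *)
Definition pswap (G : 'I_N -> 'I_N -> 'I_N -> 'I_N -> V) i j k l : V :=
  N%:R^-1 *: \sum_a \sum_b
    w ^ (z b * (z i - z k - z a)) *: G (i - a) (j - b) (k + a) (l + b).

Lemma fourier2_pswap G i j k l :
  fourier2 (pswap G) i j k l = fourier2 G k j i l.
Proof.
apply: (scalerI N_neq0).
rewrite /pswap fourier2Z scalerA mulfV ?N_neq0 // scale1r.
(* After translating x by a and y by - a, the index a only occurs in the factor
   w^(a (b - (k - i))), so that summing over a forces b = k - i. *)
pose H b := \sum_x \sum_y
  w ^ (z i * z x + z k * z y + z b * (z x - z y)) *: G x (j - i - b) y (l - k + b).
transitivity (N%:R *: H (k - i)); last first.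
  congr (_ *: _); apply: eq_bigr => x _; apply: eq_bigr => y _.
  by rewrite opprB addrA subrK addrA subrK; congr (_ *: _); omega_congr.
rewrite -(fourier_collapse H) /fourier2 scale_exchange_big2.
apply: eq_bigr => a _; apply: eq_bigr => b _.
rewrite scaler_sumr (reindex_inj (addIr a)); apply: eq_bigr => x _.
rewrite scaler_sumr (reindex_inj (addIr (- a))); apply: eq_bigr => y _.
by rewrite addrK subrK !scalerA -!omegaD; congr (_ *: _); omega_congr.
Qed.

Variable g : gtype.
Hypothesis even_symplectic : g = symplectic -> ~~ odd N.
Local Notation th := (@theta R m g).

(** Reversal preserves theta in the symmetric case and, N being even, changes its
    sign in the alternating case; products of two values are invariant either way. *)
Lemma theta_rev2 i j : th (rev_ord i) * th (rev_ord j) = th i * th j.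
Proof.
case: g even_symplectic => [|/(_ erefl) N_even]; rewrite /theta ?mulr1 //.
have N2 : N = N./2.*2 by rewrite -[LHS]odd_double_half (negbTE N_even).
have rev_lt a : (rev_ord a < N./2)%N = ~~ (a < N./2)%N.
  by move: (ltn_ord a) => /= aN; apply/idP/idP; lia.
by rewrite !rev_lt; case: (i < _)%N; case: (j < _)%N => /=; ring.
Qed.

(** The partial transpose of the permutation operator in the basis of the A_kl:
    pcontract is fourier2-conjugate to the exchange of j with k combined with
    reversal of both. *)
Definition pcontract (G : 'I_N -> 'I_N -> 'I_N -> 'I_N -> V) i j k l : V :=
  (N%:R ^+ 2)^-1 *: \sum_a \sum_b \sum_a' \sum_b'
    (th a' * th (a' + b)
     * w ^ (- z a - z a' * (z a + z b') + z b' * (z j - z b)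
                  - z b * (z k + z a)))
      *: G (i - b') (j - b) (k + a) (l + b).

Lemma fourier2_pcontract G i j k l :
  fourier2 (pcontract G) i j k l
    = (th k * th (rev_ord j)) *: fourier2 G i (rev_ord k) (rev_ord j) l.
Proof.
have N2 : N%:R ^+ 2 != 0 :> R[i] by rewrite expf_neq0 ?N_neq0.
apply: (scalerI N2); rewrite /pcontract fourier2Z scalerA mulfV // scale1r.
(* Translating x by b' and y by - a leaves a in the factor w^(a (k' - a')) and b'
   in the factor w^(b' (j - a' - b)), where k' is the reversal of k; summing over
   both forces a' = k' and b = j - k'. *)
pose H a' b := (th a' * th (a' + b)) *: \sum_x \sum_y
  w ^ (z i * z x + z k * z y - z b * z y) *: G x (j - i - b) y (l - k + b).
transitivity (N%:R *: (N%:R *: H (rev_ord k) (j - rev_ord k))); last first.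
  rewrite scalerA; congr (_ *: _); rewrite /H [_ + (j - _)]addrC subrK.
  rewrite -theta_rev2 rev_ordK; congr (_ *: _).
  apply: eq_bigr => x _; apply: eq_bigr => y _.
  have -> : j - i - (j - rev_ord k) = rev_ord k - i.
    by rewrite opprB addrC addrA subrK.
  have -> : l - k + (j - rev_ord k) = l - rev_ord j.
    rewrite -addrA; congr (_ + _).
    by rewrite addrA [- k + j]addrC -(rev_ordB k j) addrAC subrr sub0r.
  by congr (_ *: _); omega_congr.
rewrite -(fourier_collapseN (fun a' => N%:R *: H a' (j - a'))).
rewrite /fourier2 scale_exchange_big2; apply: eq_bigr => a _.
under eq_bigr do rewrite scale_exchange_big2.
rewrite exchange_big; apply: eq_bigr => a' _.
rewrite -(fourier_collapseN (H a')) scaler_sumr exchange_big; apply: eq_bigr => b' _.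
rewrite scaler_sumr; apply: eq_bigr => b _.
rewrite /H !scaler_sumr (reindex_inj (addIr b')); apply: eq_bigr => x _.
rewrite !scaler_sumr (reindex_inj (addIr (- a))); apply: eq_bigr => y _.
rewrite addrK subrK !scalerA; congr (_ *: _).
rewrite mulrCA -!mulrA [RHS]mulrA [RHS]mulrCA [X in _ = _ * X]mulrCA -!omegaD.
by congr (_ * (_ * _)); omega_congr.
Qed.

(** The permutation operator commutes with the flip of the two factors; on the sum
    this is the substitution a -> i - k - a, b -> j - l - b, and gives the form in
    which the opposite product y_kl(v) y_ij(u) enters the relation. *)
Lemma pswapC G i j k l :
  pswap G i j k l = N%:R^-1 *: \sum_a \sum_b
    w ^ (z a * (z j - z l - z b)) *: G (k + a) (l + b) (i - a) (j - b).
Proof.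
congr (_ *: _); rewrite (reindex_inj (inv_inj (subKr (i - k)))).
apply: eq_bigr => a _; rewrite (reindex_inj (inv_inj (subKr (j - l)))).
apply: eq_bigr => b _.
have swapD (x y t : 'I_N) : x - (x - y - t) = y + t.
  by rewrite !opprB addrCA [x + _]addrC subrK addrC.
have swapB (x y t : 'I_N) : y + (x - y - t) = x - t.
  by rewrite addrA [y + _]addrC subrK.
by rewrite !swapD !swapB; congr (_ *: _); omega_congr.
Qed.

(** The analogue of pswapC for the contraction; the substitution exchanges a with
    - b', negates b and replaces a' by its reversal, under which the theta factor
    is invariant. *)
Lemma pcontractC G i j k l :
  pcontract G k l i j = (N%:R ^+ 2)^-1 *: \sum_a \sum_b \sum_a' \sum_b'
    (th a' * th (a' + b)
     * w ^ (- z a - z a' * (z a + z b') + z b * (z i - z b')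
                  - z a * (z l + z b)))
      *: G (k + a) (l + b) (i - b') (j - b).
Proof.
congr (_ *: _).
rewrite exchange_big [RHS]exchange_big /=.
rewrite (reindex_inj oppr_inj); apply: eq_bigr => b _.
transitivity (\sum_a' \sum_a \sum_b'
    (th a' * th (a' - b)
     * w ^ (- z a - z a' * (z a + z b') + z b' * (z l - z (- b))
                  - z (- b) * (z i + z a)))
      *: G (k - b') (l + b) (i + a) (j - b)).
  by rewrite exchange_big /=; do 3 (apply: eq_bigr => ? _); rewrite opprK.
rewrite [RHS]exchange_big (reindex_inj rev_ord_inj); apply: eq_bigr => a' _.
rewrite exchange_big (reindex_inj oppr_inj); apply: eq_bigr => a _.
rewrite (reindex_inj oppr_inj); apply: eq_bigr => b' _.
have -> : rev_ord a' - b = rev_ord (a' + b).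
  by apply: (addIr (- rev_ord a')); rewrite rev_ordB addrAC opprD addrA !subrr !sub0r.
rewrite theta_rev2 opprK; congr ((_ * _) *: _); omega_congr.
Qed.

End Fourier.

(** * Linearity, transposition and composite operators *)

Section FourierLinear.
Variables (R : realType) (m : nat).
Local Notation N := m.+1.
Local Notation w := (omega R m).
Local Notation z i := (Posz (nat_of_ord (i : 'I_N))).
Implicit Types (i j k l a b c d : 'I_N).

Lemma fourier2_linear (V V' : lmodType R[i]) (L : {linear V -> V'})
    (G : 'I_N -> 'I_N -> 'I_N -> 'I_N -> V) i j k l :
  fourier2 (fun i j k l => L (G i j k l)) i j k l = L (fourier2 G i j k l).
Proof.
rewrite linear_sum; apply: eq_bigr => x _.
by rewrite linear_sum; apply: eq_bigr => y _; rewrite linearZ.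
Qed.

Lemma fourier_linear (V V' : lmodType R[i]) (L : {linear V -> V'})
    (f : 'I_N -> 'I_N -> V) i j :
  fourier (fun i j => L (f i j)) i j = L (fourier f i j).
Proof. by rewrite linear_sum; apply: eq_bigr => x _; rewrite linearZ. Qed.

Lemma ifourier_linear (V V' : lmodType R[i]) (L : {linear V -> V'})
    (f : 'I_N -> 'I_N -> V) i j :
  ifourier (fun i j => L (f i j)) i j = L (ifourier f i j).
Proof. by rewrite linear_sum; apply: eq_bigr => x _; rewrite linearZ. Qed.

Lemma fourier_inv (V V' : lmodType R[i]) (L : {linear V -> V'})
    (f : 'I_N -> 'I_N -> V) (h : 'I_N -> 'I_N -> V') :
  (forall i j, L (fourier f i j) = h i j) -> forall i j, L (f i j) = ifourier h i j.
Proof.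
move=> Lf i j; rewrite -[f i j]fourierK -ifourier_linear.
by apply: eq_bigr => k _; rewrite Lf.
Qed.

Lemma fourier2_inv (V V' : lmodType R[i]) (L : {linear V -> V'})
    (G : 'I_N -> 'I_N -> 'I_N -> 'I_N -> V) (H : 'I_N -> 'I_N -> 'I_N -> 'I_N -> V') :
  (forall i j k l, L (fourier2 G i j k l) = H i j k l) ->
  forall i j k l, L (G i j k l) = ifourier2 H i j k l.
Proof.
move=> LG i j k l; rewrite -[G i j k l]fourier2K linearZ linear_sum.
congr (_ *: _); apply: eq_bigr => a _; rewrite linear_sum.
by apply: eq_bigr => b _; rewrite linearZ LG.
Qed.

Variable V : lmodType R[i].
Implicit Types (G H : 'I_N -> 'I_N -> 'I_N -> 'I_N -> V) (f h : 'I_N -> 'I_N -> V).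

Lemma fourierD f h i j :
  fourier (fun i j => f i j + h i j) i j = fourier f i j + fourier h i j.
Proof. by rewrite -big_split; apply: eq_bigr => x _; rewrite scalerDr. Qed.

Lemma fourierN f i j : fourier (fun i j => - f i j) i j = - fourier f i j.
Proof. by rewrite -sumrN; apply: eq_bigr => x _; rewrite scalerN. Qed.

Lemma fourier2D G H i j k l :
  fourier2 (fun i j k l => G i j k l + H i j k l) i j k l
    = fourier2 G i j k l + fourier2 H i j k l.
Proof.
rewrite -big_split; apply: eq_bigr => x _; rewrite -big_split.
by apply: eq_bigr => y _; rewrite scalerDr.
Qed.

Lemma fourier2N G i j k l :
  fourier2 (fun i j k l => - G i j k l) i j k l = - fourier2 G i j k l.
Proof.
rewrite -sumrN; apply: eq_bigr => x _; rewrite -sumrN.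
by apply: eq_bigr => y _; rewrite scalerN.
Qed.

Lemma fourier2_swap G i j k l :
  fourier2 (fun i j k l => G k l i j) i j k l = fourier2 G k l i j.
Proof.
rewrite /fourier2 exchange_big; apply: eq_bigr => x _; apply: eq_bigr => y _.
by rewrite addrC.
Qed.

Variable g : gtype.
Local Notation th := (@theta R m g).

(** The transposition E_ij -> theta_i theta_j E_(j',i') in the basis of the A_kl. *)
Definition ptranspose f i j : V :=
  N%:R^-1 *: \sum_k \sum_l
    (th k * th (k + j) * w ^ (- z l * (1 + z j) - z k * (z i + z l))) *: f l j.

Lemma fourier_ptranspose f i j :
  fourier (ptranspose f) i j
    = (th i * th j) *: fourier f (rev_ord j) (rev_ord i).
Proof.
apply: (scalerI (N_neq0 R m)).
(* The outer sum over x pairs with i - k and forces k = i. *)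
pose H k := \sum_l
  (th k * th (k + (j - i)) * w ^ (- z l * (1 + z j - z i) - z k * z l)) *: f l (j - i).
transitivity (N%:R *: H i); last first.
  congr (_ *: _); rewrite /H addrC subrK scaler_sumr; apply: eq_bigr => l _.
  rewrite rev_ordB scalerA; congr ((_ * _) *: _); omega_congr.
rewrite -(fourier_collapseN H) scaler_sumr; apply: eq_bigr => x _.
rewrite scalerA mulrC -scalerA [N%:R *: _]scalerA mulfV ?N_neq0 // scale1r.
rewrite scaler_sumr; apply: eq_bigr => k _.
rewrite !scaler_sumr; apply: eq_bigr => l _.
rewrite !scalerA; congr (_ *: _); rewrite [RHS]mulrCA.
rewrite [LHS]mulrCA -!omegaD; congr (_ * _); omega_congr.
Qed.

Lemma scale_sum2 (n : R[i]) (e : 'I_N -> 'I_N -> R[i]) (F : 'I_N -> 'I_N -> V) :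
  \sum_c \sum_d e c d *: (n *: F c d) = n *: \sum_c \sum_d e c d *: F c d.
Proof.
rewrite scaler_sumr; apply: eq_bigr => c _; rewrite scaler_sumr.
by apply: eq_bigr => d _; rewrite !scalerA mulrC.
Qed.

(** The first sixfold sum of the principal relation is a composite of operators:
    c and d are the shifts of pswap, and a, b, a', b' those of pcontract. *)
Lemma pswap_pcontract G i j k l :
  pswap (pcontract g G) i j k l = (N%:R ^+ 3)^-1 *:
    \sum_a \sum_b \sum_a' \sum_b' \sum_c \sum_d
      (th a' * th (a' + b)
       * w ^ (- z a - z a' * (z a + z b')
                          + z b' * (z j - z b - z d)
                          - z b * (z k + z a + z c) + z d * (z i - z k - z c)))
        *: G (i - c - b') (j - d - b) (k + a + c) (l + b + d).
Proof.
rewrite /pswap /pcontract scale_sum2 scalerA -invfM -exprS.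
congr (_ *: _); rewrite scale_exchange_big2.
apply: eq_bigr => a _; apply: eq_bigr => b _; rewrite scale_exchange_big2.
do 2 (apply: eq_bigr => ? _); apply: eq_bigr => c _; apply: eq_bigr => d _.
rewrite scalerA mulrCA -omegaD (addrAC k c a) (addrAC l d b).
congr (_ * _ *: _); omega_congr.
Qed.

Hypothesis even_symplectic : g = symplectic -> ~~ odd N.

(** Flipping both operators as in pswapC and pcontractC gives the second sixfold
    sum of the principal relation, with the factors in the opposite order. *)
Lemma pswap_pcontractC G i j k l :
  pswap (pcontract g G) i j k l = (N%:R ^+ 3)^-1 *:
    \sum_a \sum_b \sum_a' \sum_b' \sum_c \sum_d
      (th a' * th (a' + b)
       * w ^ (- z a - z a' * (z a + z b')
                          + z b * (z i - z c - z b')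
                          - z a * (z l + z b + z d) + z c * (z j - z l - z d)))
        *: G (k + a + c) (l + b + d) (i - c - b') (j - d - b).
Proof.
rewrite pswapC.
under eq_bigr do under eq_bigr do rewrite pcontractC //.
rewrite scale_sum2 scalerA -invfM -exprS.
congr (_ *: _); rewrite scale_exchange_big2.
apply: eq_bigr => a _; apply: eq_bigr => b _; rewrite scale_exchange_big2.
do 2 (apply: eq_bigr => ? _); apply: eq_bigr => c _; apply: eq_bigr => d _.
rewrite scalerA mulrCA -omegaD (addrAC k c a) (addrAC l d b).
congr (_ * _ *: _); omega_congr.
Qed.

End FourierLinear.

(** * The two kinds of relations as operations on arrays *)

Section SeriesLinear.
Variables (K : fieldType) (A : lalgType K).

Lemma mul_uDv_linear : linear (@mul_uDv K A).
Proof.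
move=> c F G; apply/funext=> p; apply/funext=> q.
by rewrite /mul_uDv /mul_u /mul_v /= !fctE scalerDr addrACA.
Qed.
HB.instance Definition _ :=
  GRing.isLinear.Build K _ _ _ (@mul_uDv K A) mul_uDv_linear.

Lemma mul_uBv_linear : linear (@mul_uBv K A).
Proof.
move=> c F G; apply/funext=> p; apply/funext=> q.
by rewrite /mul_uBv /mul_u /mul_v /= !fctE scalerBr opprD addrACA.
Qed.
HB.instance Definition _ :=
  GRing.isLinear.Build K _ _ _ (@mul_uBv K A) mul_uBv_linear.

Lemma mul_u2Bv2_linear : linear (@mul_u2Bv2 K A).
Proof.
move=> c F G; apply/funext=> p; apply/funext=> q.
by rewrite /mul_u2Bv2 /mul_u /mul_v /= !fctE scalerBr opprD addrACA.
Qed.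
HB.instance Definition _ :=
  GRing.isLinear.Build K _ _ _ (@mul_u2Bv2 K A) mul_u2Bv2_linear.

Lemma neg_arg_linear : linear (@neg_arg K A).
Proof.
move=> c f g; apply/funext=> p.
by rewrite /neg_arg !fctE scalerDr !scalerA mulrC.
Qed.
HB.instance Definition _ := GRing.isLinear.Build K _ _ _ (@neg_arg K A) neg_arg_linear.

Lemma div_u_linear : linear (@div_u K A).
Proof. by []. Qed.
HB.instance Definition _ := GRing.isLinear.Build K _ _ _ (@div_u K A) div_u_linear.

End SeriesLinear.

Section PrincipalForm.
Variables (R : realType) (m : nat) (g : gtype) (V : lmodType R[i]).
Hypothesis even_symplectic : g = symplectic -> ~~ odd m.+1.
Local Notation N := m.+1.
Local Notation w := (omega R m).
Local Notation z i := (Posz (nat_of_ord (i : 'I_N))).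
Local Notation th := (@theta R m g).
Implicit Types (i j k l a b c d : 'I_N).

(** The nested sums of the principal relation, regrouped by operator.  D and E are
    the arrays of products in the two orders; L and L' are multiplication by u + v
    and by u - v.  Keeping the module abstract separates the combinatorics of the
    indices from the series and from the free algebra. *)
Lemma principal_form (L L' : {linear V -> V})
    (D E : 'I_N -> 'I_N -> 'I_N -> 'I_N -> V) i j k l :
  N%:R^-1 *: L (\sum_a \sum_b
    (w ^ (z b * (z i - z k - z a)) *: D (i - a) (j - b) (k + a) (l + b)
     - w ^ (z a * (z j - z l - z b)) *: E (k + a) (l + b) (i - a) (j - b)))
  - (N%:R ^+ 2)^-1 *: L' (\sum_a \sum_b \sum_a' \sum_b'
      (th a' * th (a' + b)
       * w ^ (- z a - z a' * (z a + z b') + z b' * (z j - z b)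
                    - z b * (z k + z a)))
        *: D (i - b') (j - b) (k + a) (l + b))
  + (N%:R ^+ 2)^-1 *: L' (\sum_a \sum_b \sum_a' \sum_b'
      (th a' * th (a' + b)
       * w ^ (- z a - z a' * (z a + z b') + z b * (z i - z b')
                    - z a * (z l + z b)))
        *: E (k + a) (l + b) (i - b') (j - b))
  + (N%:R ^+ 3)^-1 *:
    (\sum_a \sum_b \sum_a' \sum_b' \sum_c \sum_d
      (th a' * th (a' + b)
       * w ^ (- z a - z a' * (z a + z b')
                    + z b' * (z j - z b - z d)
                    - z b * (z k + z a + z c) + z d * (z i - z k - z c)))
        *: D (i - c - b') (j - d - b) (k + a + c) (l + b + d))
  - (N%:R ^+ 3)^-1 *:
    (\sum_a \sum_b \sum_a' \sum_b' \sum_c \sum_d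
      (th a' * th (a' + b)
       * w ^ (- z a - z a' * (z a + z b')
                    + z b * (z i - z c - z b')
                    - z a * (z l + z b + z d) + z c * (z j - z l - z d)))
        *: E (k + a + c) (l + b + d) (i - c - b') (j - d - b))
  = L (pswap D i j k l - pswap E i j k l)
    - L' (pcontract g D i j k l - pcontract g E k l i j)
    + (pswap (pcontract g D) i j k l - pswap (pcontract g E) i j k l).
Proof.
rewrite pswap_pcontract (pswap_pcontractC even_symplectic E) addrA.
rewrite (pcontractC even_symplectic E i j) (pswapC E) /pswap /pcontract.
congr (_ + _ - _); rewrite (linearB L') opprB addrA addrAC.
congr (_ - _ + _); [rewrite -scalerBr linearZ | by rewrite linearZ..].
rewrite -sumrB; congr (_ *: L _).
by apply: eq_bigr => a _; rewrite -sumrB.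
Qed.


Section Quaternary.
Variables L0 L L' : {linear V -> V}.

(** Left minus right side of the quaternary relation, with L0, L, L' for
    multiplication by u^2 - v^2, u + v and u - v, and with D, E for the arrays of
    products x_ij(u) x_kl(v) and x_ij(v) x_kl(u). *)
Definition quat (D E : 'I_N -> 'I_N -> 'I_N -> 'I_N -> V) i j k l : V :=
  L0 (D i j k l - E k l i j)
  - (L (D k j i l - E k j i l)
     - L' ((th k * th (rev_ord j)) *: D i (rev_ord k) (rev_ord j) l
           - (th i * th (rev_ord l)) *: E k (rev_ord i) (rev_ord l) j)
     + (th i * th (rev_ord j))
         *: (D k (rev_ord i) (rev_ord j) l - E k (rev_ord i) (rev_ord j) l)).

Definition pquat (D E : 'I_N -> 'I_N -> 'I_N -> 'I_N -> V) i j k l : V :=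
  L0 (D i j k l - E k l i j)
  - (L (pswap D i j k l - pswap E i j k l)
     - L' (pcontract g D i j k l - pcontract g E k l i j)
     + (pswap (pcontract g D) i j k l - pswap (pcontract g E) i j k l)).

Lemma fourier2_pquat D E i j k l :
  fourier2 (pquat D E) i j k l = quat (fourier2 D) (fourier2 E) i j k l.
Proof.
rewrite /pquat /quat.
rewrite !(fourier2D, fourier2N, fourier2_linear L0, fourier2_linear L,
  fourier2_linear L').
rewrite (fourier2_swap E) (fourier2_swap (pcontract g E)).
by rewrite !fourier2_pswap !fourier2_pcontract // scalerBr.
Qed.

Lemma quat_natural (M : {linear V -> V}) D E D' E' i j k l :
  (forall x, M (L0 x) = L0 (M x)) ->
  (forall x, M (L x) = L (M x)) -> (forall x, M (L' x) = L' (M x)) ->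
  (forall i j k l, M (D i j k l) = D' i j k l) ->
  (forall i j k l, M (E i j k l) = E' i j k l) ->
  M (quat D E i j k l) = quat D' E' i j k l.
Proof.
move=> ML0 ML ML' MD ME.
by rewrite /quat !(linearB M, linearD M, ML0, ML, ML', linearZ_LR M, MD, ME).
Qed.

End Quaternary.

Section Symmetry.
Variables Ln Ld : {linear V -> V}.

(** Left minus right side of the symmetry relation, with Ln for the substitution
    u -> - u and Ld for division by u. *)
Definition sym (f : 'I_N -> 'I_N -> V) i j : V :=
  (th i * th j) *: Ln (f (rev_ord j) (rev_ord i))
  - (f i j + pm R g *: (2^-1 *: Ld (f i j - Ln (f i j)))).

Definition psym (f : 'I_N -> 'I_N -> V) i j : V :=
  ptranspose g (fun i j => Ln (f i j)) i j
  - (f i j + pm R g *: (2^-1 *: Ld (f i j - Ln (f i j)))).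

Lemma fourier_psym f i j : fourier (psym f) i j = sym (fourier f) i j.
Proof.
rewrite /psym /sym !(fourierD, fourierN) fourier_ptranspose (fourier_linear Ln).
rewrite 2!(fourier_linear ( *:%R _)) (fourier_linear Ld).
by rewrite (fourierD f) fourierN (fourier_linear Ln).
Qed.

Lemma sym_natural (M : {linear V -> V}) f f' i j :
  (forall x, M (Ln x) = Ln (M x)) -> (forall x, M (Ld x) = Ld (M x)) ->
  (forall i j, M (f i j) = f' i j) -> M (sym f i j) = sym f' i j.
Proof.
move=> MLn MLd Mf.
by rewrite /sym !(linearB M, linearD M, MLn, MLd, linearZ_LR M, Mf).
Qed.

End Symmetry.

End PrincipalForm.

(** * Relations between generating series *)

Section AlgebraSeries.
Variables (R : realType) (m : nat) (g : gtype) (A : lalgType R[i]).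
Local Notation N := m.+1.
Implicit Types (i j k l : 'I_N) (f : 'I_N -> 'I_N -> int -> A).
Implicit Types (D E : 'I_N -> 'I_N -> 'I_N -> 'I_N -> int -> int -> A).

Definition uv f i j k l : int -> int -> A := f i j *uv f k l.
Definition vu f i j k l : int -> int -> A := f i j *vu f k l.

Definition quatA D E i j k l : int -> int -> A :=
  quat g (@mul_u2Bv2 _ A) (@mul_uDv _ A) (@mul_uBv _ A) D E i j k l.
Definition pquatA D E i j k l : int -> int -> A :=
  pquat g (@mul_u2Bv2 _ A) (@mul_uDv _ A) (@mul_uBv _ A) D E i j k l.
Definition symA f i j : int -> A := sym g (@neg_arg _ A) (@div_u _ A) f i j.
Definition psymA f i j : int -> A := psym g (@neg_arg _ A) (@div_u _ A) f i j.

Section Evaluation.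
Variables p q : int.

Definition eval1 (F : int -> A) : A := F p.
Definition eval2 (F : int -> int -> A) : A := F p q.

Lemma eval1_linear : linear eval1.
Proof. by []. Qed.
HB.instance Definition _ := GRing.isLinear.Build R[i] _ _ _ eval1 eval1_linear.

Lemma eval2_linear : linear eval2.
Proof. by []. Qed.
HB.instance Definition _ := GRing.isLinear.Build R[i] _ _ _ eval2 eval2_linear.

Lemma fourier_eval f i j : fourier f i j p = fourier (fun i j => f i j p) i j.
Proof. by rewrite (fourier_linear eval1). Qed.

Lemma fourier2_eval D i j k l :
  fourier2 D i j k l p q = fourier2 (fun i j k l => D i j k l p q) i j k l.
Proof. by rewrite (fourier2_linear eval2). Qed.

End Evaluation.

Section Morphism.
Variable h : {linear A -> A}.
Hypothesis hM : {morph h : x y / x * y}.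

Definition map_coef1 (F : int -> A) : int -> A := fun p => h (F p).
Definition map_coef2 (F : int -> int -> A) : int -> int -> A := fun p q => h (F p q).

Lemma map_coef1_linear : linear map_coef1.
Proof. by move=> c F G; apply/funext=> p; rewrite /map_coef1 linearP. Qed.
HB.instance Definition _ := GRing.isLinear.Build R[i] _ _ _ map_coef1 map_coef1_linear.

Lemma map_coef2_linear : linear map_coef2.
Proof.
by move=> c F G; apply/funext=> p; apply/funext=> q; rewrite /map_coef2 linearP.
Qed.
HB.instance Definition _ := GRing.isLinear.Build R[i] _ _ _ map_coef2 map_coef2_linear.

(** A morphism applied to the coefficients commutes with multiplication by u and v
    and with products, so it carries the relation of a family of series to the
    relation of the image family. *)
Lemma quatA_morph f i j k l p q :
  let hf i j p := h (f i j p) in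
  h (quatA (uv f) (vu f) i j k l p q) = quatA (uv hf) (vu hf) i j k l p q.
Proof.
move=> hf; rewrite -[LHS]/(map_coef2 (quatA (uv f) (vu f) i j k l) p q).
have map_comm (mul : (int -> int -> A) -> int -> int -> A) :
    (forall F p q, h (mul F p q) = mul (map_coef2 F) p q) ->
    forall F, map_coef2 (mul F) = mul (map_coef2 F).
  by move=> hmul F; apply/funext=> p'; apply/funext=> q'; exact: hmul.
have C0 : forall F, map_coef2 (mul_u2Bv2 F) = mul_u2Bv2 (map_coef2 F).
  by apply: map_comm => F p' q'; rewrite [LHS]linearB.
have C1 : forall F, map_coef2 (mul_uDv F) = mul_uDv (map_coef2 F).
  by apply: map_comm => F p' q'; rewrite [LHS]linearD.
have C2 : forall F, map_coef2 (mul_uBv F) = mul_uBv (map_coef2 F).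
  by apply: map_comm => F p' q'; rewrite [LHS]linearB.
have C3 i' j' k' l' : map_coef2 (uv f i' j' k' l') = uv hf i' j' k' l'.
  by apply/funext=> p'; apply/funext=> q'; exact: hM.
have C4 i' j' k' l' : map_coef2 (vu f i' j' k' l') = vu hf i' j' k' l'.
  by apply/funext=> p'; apply/funext=> q'; exact: hM.
by rewrite /quatA (quat_natural g i j k l C0 C1 C2 C3 C4).
Qed.

Lemma symA_morph f i j p :
  h (symA f i j p) = symA (fun i j p => h (f i j p)) i j p.
Proof.
rewrite -[LHS]/(map_coef1 (symA f i j) p) /symA.
have C : forall F, map_coef1 (neg_arg F) = neg_arg (map_coef1 F).
  by move=> F; apply/funext=> p'; rewrite /map_coef1 /neg_arg linearZ.
have C' : forall F, map_coef1 (div_u F) = div_u (map_coef1 F) by [].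
by rewrite (sym_natural g i j C C' (fun _ _ => erefl)).
Qed.

End Morphism.

Hypothesis scaleAr : forall (c : R[i]) (x y : A), c *: (x * y) = x * (c *: y).

Lemma uv_fourier f : uv (fourier f) = fourier2 (uv f).
Proof.
apply/funext=> i; apply/funext=> j; apply/funext=> k; apply/funext=> l.
apply/funext=> p; apply/funext=> q.
rewrite /fourier2 fct_sumE fct_sumE /uv /prod_uv /fourier fct_sumE mulr_suml.
apply: eq_bigr => x _; rewrite 3!fct_sumE mulr_sumr; apply: eq_bigr => y' _.
by rewrite -scalerAl -scaleAr scalerA -omegaD.
Qed.

Lemma vu_fourier f : vu (fourier f) = fourier2 (vu f).
Proof.
apply/funext=> i; apply/funext=> j; apply/funext=> k; apply/funext=> l.
apply/funext=> p; apply/funext=> q.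
rewrite /fourier2 fct_sumE fct_sumE /vu /prod_vu /fourier fct_sumE mulr_suml.
apply: eq_bigr => x _; rewrite 3!fct_sumE mulr_sumr; apply: eq_bigr => y' _.
by rewrite -scalerAl -scaleAr scalerA -omegaD.
Qed.

Hypothesis even_symplectic : g = symplectic -> ~~ odd N.

(** In matrix units, the relation of the transformed family is the transform of
    the principal relations: products of transformed series are transformed
    products, and fourier2 turns pquat into quat. *)
Lemma quatA_fourier f i j k l p q :
  quatA (uv (fourier f)) (vu (fourier f)) i j k l p q
    = fourier2 (fun i j k l => pquatA (uv f) (vu f) i j k l p q) i j k l.
Proof.
by rewrite -fourier2_eval uv_fourier vu_fourier /quatA -fourier2_pquat.
Qed.

Lemma symA_fourier f i j p :
  symA (fourier f) i j p = fourier (fun i j => psymA f i j p) i j.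
Proof. by rewrite -fourier_eval /symA -fourier_psym. Qed.

End AlgebraSeries.

Section DefiningRelations.
Variables (R : realType) (m : nat) (g : gtype).
Hypothesis even_symplectic : g = symplectic -> ~~ odd m.+1.
Local Notation N := m.+1.
Local Notation A := (free_alg R[i] (yangian_index m)).
Implicit Types (i j k l : 'I_N).
Local Notation s := (@s_series R m).
Local Notation y := (@y_series R m).

(** In the next five lemmas the two sides are convertible up to unfolding, but
    derive their module structures along different paths; the comparison is left
    to the kernel, since unification explores these paths at every node. *)
Lemma quaternaryE i j k l p q :
  quaternary_lhs R i j k l p q - quaternary_rhs R g i j k l p q
    = quatA g (uv s) (vu s) i j k l p q.
Proof. exact_no_check (erefl (quatA g (uv s) (vu s) i j k l p q)). Qed.

Lemma symmetryE i j p :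
  symmetry_lhs R g i j p - symmetry_rhs R g i j p = symA g s i j p.
Proof. exact_no_check (erefl (symA g s i j p)). Qed.

Lemma psymmetryE i j p :
  psymmetry_lhs R g i j p - psymmetry_rhs R g i j p = psymA g y i j p.
Proof. exact_no_check (erefl (psymA g y i j p)). Qed.

Lemma pquaternary_rhsE i j k l (D := uv y) (E := vu y) :
  pquaternary_rhs R g i j k l
    = mul_uDv (pswap D i j k l - pswap E i j k l)
      - mul_uBv (pcontract g D i j k l - pcontract g E k l i j)
      + (pswap (pcontract g D) i j k l - pswap (pcontract g E) i j k l).
Proof.
exact_no_check (principal_form even_symplectic
  (@mul_uDv _ A) (@mul_uBv _ A) (uv y) (vu y) i j k l).
Qed.

Lemma pquaternaryE i j k l p q :
  pquaternary_lhs R i j k l p q - pquaternary_rhs R g i j k l p q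
    = pquatA g (uv y) (vu y) i j k l p q.
Proof.
exact_no_check (congr1 (fun F => pquaternary_lhs R i j k l p q - F p q)
  (pquaternary_rhsE i j k l)).
Qed.

End DefiningRelations.

(** * The isomorphism *)

Section Maps.
Variables (R : realType) (m : nat) (g : gtype).
Hypothesis even_symplectic : g = symplectic -> ~~ odd m.+1.
Local Notation N := m.+1.
Local Notation A := (free_alg R[i] (yangian_index m)).
Implicit Types (i j k l : 'I_N).
Local Notation s := (@s_series R m).
Local Notation y := (@y_series R m).
Local Notation gen r := (fun i j => free_gen R[i] (i, j, r)).

Definition s_to_y : A -> A :=
  free_subst (fun t : yangian_index m => fourier (gen t.2) t.1.1 t.1.2).
Definition y_to_s : A -> A :=
  free_subst (fun t : yangian_index m => ifourier (gen t.2) t.1.1 t.1.2).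

HB.instance Definition _ := GRing.LRMorphism.on s_to_y.
HB.instance Definition _ := GRing.LRMorphism.on y_to_s.

(** The constant terms of the two families correspond: the identity matrix is
    A_00. *)
Lemma fourier_delta i j :
  fourier (fun k l => ((k == 0) && (l == 0))%:R : A) i j = (i == j)%:R.
Proof.
rewrite /fourier (bigD1 0) //= mulr0 expr0z scale1r subr_eq0 eq_sym.
by rewrite big1 ?addr0 // => k /negbTE->; rewrite scaler0.
Qed.

Lemma s_to_y_series i j p : s_to_y (s i j p) = fourier (fun k l => y k l p) i j.
Proof.
case: p => [[|r]|r] /=; last exact: free_subst_gen.
  by rewrite rmorph_nat fourier_delta.
by rewrite raddf0 /fourier big1 // => k _; rewrite scaler0.
Qed.

Lemma y_to_s_series k l p : y_to_s (y k l p) = ifourier (fun i j => s i j p) k l.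
Proof.
case: p => [[|r]|r] /=; last exact: free_subst_gen.
  rewrite rmorph_nat -[LHS](fourierK (fun k l => ((k == 0) && (l == 0))%:R)).
  by apply: eq_bigr => i _; rewrite fourier_delta.
by rewrite raddf0 /ifourier big1 // => k' _; rewrite scaler0.
Qed.

Lemma s_to_y_gen i j r : s_to_y (gen r i j) = fourier (gen r) i j.
Proof. exact: free_subst_gen. Qed.

Lemma y_to_s_gen i j r : y_to_s (gen r i j) = ifourier (gen r) i j.
Proof. exact: free_subst_gen. Qed.

Lemma s_to_yK : cancel s_to_y y_to_s.
Proof.
elim/free_alg_ind => [|[[i j] r] x IHx|c x x' IHx IHx'].
- exact: (rmorph1 (y_to_s \o s_to_y)).
- rewrite [LHS](rmorphM (y_to_s \o s_to_y)); apply: (congr2 *%R _ IHx) => /=.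
  rewrite s_to_y_gen -(fourier_linear y_to_s) -[RHS](ifourierK (gen r)).
  by apply: eq_bigr => k _; congr (_ *: _); exact: y_to_s_gen.
- exact: etrans (linearP (y_to_s \o s_to_y) c x x')
    (congr2 (fun u v => c *: u + v) IHx IHx').
Qed.

Lemma y_to_sK : cancel y_to_s s_to_y.
Proof.
elim/free_alg_ind => [|[[i j] r] x IHx|c x x' IHx IHx'].
- exact: (rmorph1 (s_to_y \o y_to_s)).
- rewrite [LHS](rmorphM (s_to_y \o y_to_s)); apply: (congr2 *%R _ IHx) => /=.
  rewrite y_to_s_gen -(ifourier_linear s_to_y) -[RHS](fourierK (gen r)).
  by apply: eq_bigr => k _; congr (_ *: _); exact: s_to_y_gen.
- exact: etrans (linearP (s_to_y \o y_to_s) c x x')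
    (congr2 (fun u v => c *: u + v) IHx IHx').
Qed.

Lemma rel_ideal_fourier (rel : A -> Prop) F i j :
  (forall k l, rel_ideal rel (F k l)) -> rel_ideal rel (fourier F i j).
Proof. by move=> IF; apply: rel_ideal_sum => k; exact: rel_idealZ. Qed.

Lemma rel_ideal_ifourier (rel : A -> Prop) F i j :
  (forall k l, rel_ideal rel (F k l)) -> rel_ideal rel (ifourier F i j).
Proof. by move=> IF; apply: rel_ideal_sum => k; exact: rel_idealZ. Qed.

Lemma rel_ideal_fourier2 (rel : A -> Prop) F i j k l :
  (forall i j k l, rel_ideal rel (F i j k l)) -> rel_ideal rel (fourier2 F i j k l).
Proof.
by move=> IF; apply: rel_ideal_sum => a; apply: rel_ideal_sum => b; exact: rel_idealZ.
Qed.

Lemma rel_ideal_ifourier2 (rel : A -> Prop) F i j k l :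
  (forall i j k l, rel_ideal rel (F i j k l)) -> rel_ideal rel (ifourier2 F i j k l).
Proof.
move=> IF; apply: rel_idealZ.
by apply: rel_ideal_sum => a; apply: rel_ideal_sum => b; exact: rel_idealZ.
Qed.

Local Notation quat_rel i j k l p q :=
  (quaternary_lhs R i j k l p q - quaternary_rhs R g i j k l p q).
Local Notation sym_rel i j p := (symmetry_lhs R g i j p - symmetry_rhs R g i j p).
Local Notation pquat_rel i j k l p q :=
  (pquaternary_lhs R i j k l p q - pquaternary_rhs R g i j k l p q).
Local Notation psym_rel i j p := (psymmetry_lhs R g i j p - psymmetry_rhs R g i j p).

(** This holds already in the free algebra, as an exact identity of transforms
    rather than a membership in the ideal, so that Fourier inversion applies to it. *)
Lemma s_to_y_quaternary i j k l p q :
  s_to_y (quat_rel i j k l p q)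
    = fourier2 (fun i j k l => pquat_rel i j k l p q) i j k l.
Proof.
apply: (etrans (congr1 s_to_y (quaternaryE R g i j k l p q))).
rewrite (quatA_morph g (h := s_to_y)); last by move=> x x'; exact: rmorphM.
have -> : (fun i j p => s_to_y (s i j p)) = fourier y.
  by do 3 apply/funext=> ?; rewrite s_to_y_series fourier_eval.
have scaleAr := @free_scalerAr R[i] (yangian_index m).
apply: (etrans (quatA_fourier scaleAr even_symplectic y i j k l p q)).
apply: eq_bigr => a _; apply: eq_bigr => b _.
have pquatE := pquaternaryE R even_symplectic a (j - i) b (l - k) p q.
exact: (congr1 ( *:%R _) (esym pquatE)).
Qed.

Lemma s_to_y_symmetry i j p :
  s_to_y (sym_rel i j p) = fourier (fun i j => psym_rel i j p) i j.
Proof.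
apply: (etrans (congr1 s_to_y (symmetryE R g i j p))).
rewrite (symA_morph g s_to_y).
have -> : (fun i j p => s_to_y (s i j p)) = fourier y.
  by do 3 apply/funext=> ?; rewrite s_to_y_series fourier_eval.
apply: (etrans (symA_fourier g y i j p)); apply: eq_bigr => a _.
exact: (congr1 ( *:%R _) (esym (psymmetryE R g a (j - i) p))).
Qed.

Lemma s_to_y_rel x :
  yangian_rel g x -> rel_ideal (@pyangian_rel R m g) (s_to_y x).
Proof.
case=> [i j k l p q|i j p].
  rewrite s_to_y_quaternary; apply: rel_ideal_fourier2 => *.
  apply: rel_ideal_gen; exact: pquaternary_rel.
rewrite s_to_y_symmetry; apply: rel_ideal_fourier => *.
apply: rel_ideal_gen; exact: psymmetry_rel.
Qed.

(** By Fourier inversion a principal relation is a combination of images under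
    s_to_y of original relations, and y_to_s undoes s_to_y. *)
Lemma y_to_s_rel x :
  pyangian_rel g x -> rel_ideal (@yangian_rel R m g) (y_to_s x).
Proof.
case=> [i j k l p q|i j p].
  have inv i' j' k' l' : y_to_s (fourier2 (fun i j k l => pquat_rel i j k l p q)
      i' j' k' l') = quat_rel i' j' k' l' p q.
    exact: etrans (congr1 y_to_s (esym (s_to_y_quaternary _ _ _ _ p q))) (s_to_yK _).
  rewrite [y_to_s _](fourier2_inv inv).
  by apply: rel_ideal_ifourier2 => *; apply: rel_ideal_gen; exact: quaternary_rel.
have inv i' j' : y_to_s (fourier (fun i j => psym_rel i j p) i' j') = sym_rel i' j' p.
  exact: etrans (congr1 y_to_s (esym (s_to_y_symmetry _ _ p))) (s_to_yK _).
rewrite [y_to_s _](fourier_inv inv).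
by apply: rel_ideal_ifourier => *; apply: rel_ideal_gen; exact: symmetry_rel.
Qed.

End Maps.

Theorem theorem4p4 (R : realType) (m : nat) (g : gtype)
    (even_symplectic : g = symplectic -> ~~ odd m.+1) :
  exists (phi : {rmorphism yangian R m g -> principal_yangian R m g})
         (psi : {rmorphism principal_yangian R m g -> yangian R m g}),
    [/\ scalable phi /\ scalable psi,
        forall (i j : 'I_m.+1) (p : int),
          phi (s_gen g i j p)
          = \sum_(k : 'I_m.+1) omega R m ^ (Posz i * Posz k) *: y_gen g k (j - i) p,
        forall (k l : 'I_m.+1) (p : int),
          psi (y_gen g k l p)
          = \sum_(i : 'I_m.+1)
              (omega R m ^ (- (Posz k * Posz i)) / m.+1%:R) *: s_gen g i (i + l) p
      & cancel phi psi /\ cancel psi phi].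
Proof.
exists (pres_map (s_to_y_rel even_symplectic)), (pres_map (y_to_s_rel even_symplectic)).
split.
- by split; exact: pres_map_scalable.
- move=> i j p; apply: (etrans (pres_mapE _ _)).
  rewrite [LHS](congr1 (pres_pi _) (s_to_y_series R i j p)) pres_pi_sum.
  by apply: eq_bigr => k _; rewrite -pres_scaleE.
- move=> k l p; apply: (etrans (pres_mapE _ _)).
  rewrite [LHS](congr1 (pres_pi _) (y_to_s_series R k l p)) pres_pi_sum.
  by apply: eq_bigr => i _; rewrite -pres_scaleE.
- by split; apply: pres_map_cancel; [exact: s_to_yK | exact: y_to_sK].
Qed.
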